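(* Under conditions (C1) and (C2), the left ideal $\mathfrak I=D_m\ell_1+\cdots+D_m\ell_m$ of the Weyl algebra $D_m$ (equivalently the system $\mathcal F_C^{p,m}(a,B)$) has rank $p^m$.
   Context: $D_m=\mathbb C\langle x_1,\dots,x_m,\partial_1,\dots,\partial_m\rangle$ is the Weyl algebra ($\partial_k=\partial/\partial x_k$). For parameters $a_1,\dots,a_p\in\mathbb C$, $b_{j,k}\in\mathbb C$ ($1\le j\le p-1$, $1\le k\le m$, $b_{j,k}\notin\{0,-1,-2,\dots\}$) and $b_{p,k}=1$, set $\ell_k=\prod_{i=1}^p(x_k\partial_k+b_{i,k}-1)-x_k\prod_{i=1}^p\big(\sum_{j=1}^m x_j\partial_j+a_i\big)$, $k=1,\dots,m$. Conditions: (C1) $a_i-\sum_{k=1}^m b_{j_k,k}\notin\mathbb Z$ for all $1\le i\le p$ and all $(j_1,\dots,j_m)\in\{1,\dots,p\}^m$; (C2) $b_{j,k}-b_{j',k}\notin\mathbb Z$ for $1\le j<j'\le p$, $1\le k\le m$. Rank: with the order filtration on $D_m$ and $\operatorname{gr}D_m\cong\mathbb C[x,\xi]$, $\operatorname{in}(\mathfrak I)$ is the ideal of principal symbols of elements of $\mathfrak I$, and $\operatorname{rank}(\mathfrak I)=\dim_{\mathbb C(x)}\mathbb C(x)[\xi]/(\mathbb C(x)[\xi]\operatorname{in}(\mathfrak I))$, which equals the dimension of the solution space near a generic point. *)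

(* Defs.v *)
From HB Require Import structures.
From mathcomp Require Import all_boot all_order all_algebra.
From mathcomp Require Import mpoly complex reals.
Set Implicit Arguments. Unset Strict Implicit. Unset Printing Implicit Defensive.
Import Order.TTheory GRing.Theory Num.Theory.
Local Open Scope ring_scope.

(* The Weyl algebra D_m over a field C is represented by its normally    *)
(* ordered elements  sum_beta p_beta(x) d^beta  (x's to the left of the  *)
(* d's), i.e. as elements of C[x][d] = {mpoly {mpoly C[m]}[m]}: the      *)
(* inner variables are x_1..x_m, the outer ones d_1..d_m.  The product   *)
(* of D_m is defined below from the relations  d_j x_i = x_i d_j + [i=j]. *)

Section Weyl.
Variables (C : fieldType) (m : nat).

Definition Xpoly := {mpoly C[m]}.
Definition Weyl := {mpoly Xpoly[m]}.

(* left multiplication by d_j :  d_j * (q d^delta) = q d_j d^delta + (dq/dx_j) d^delta *)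
Definition dmul (j : 'I_m) (Q : Weyl) : Weyl :=
  Q * 'X_j + map_mpoly (fun q : Xpoly => mderiv j q) Q.

Definition dpow (b : 'X_{1..m}) (Q : Weyl) : Weyl :=
  foldr (fun j acc => iter (b j) (dmul j) acc) Q (enum 'I_m).

Definition wmul (P Q : Weyl) : Weyl :=
  \sum_(b <- msupp P) (P@_b) *: dpow b Q.

Definition wx (j : 'I_m) : Weyl := ('X_j : Xpoly)%:MP.
Definition wd (j : 'I_m) : Weyl := 'X_j.
Definition wc (c : C) : Weyl := ((c%:MP : Xpoly))%:MP.

Definition theta_k (k : 'I_m) : Weyl := wmul (wx k) (wd k).
Definition theta : Weyl := \sum_(j < m) theta_k j.

Definition ell (p : nat) (a : 'I_p -> C) (b : 'I_p -> 'I_m -> C) (k : 'I_m) : Weyl :=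
  \big[wmul/1]_(i < p) (theta_k k + wc (b i k - 1))
  - wmul (wx k) (\big[wmul/1]_(i < p) (theta + wc (a i))).

Definition left_ideal_gen (L : 'I_m -> Weyl) (P : Weyl) : Prop :=
  exists Q : 'I_m -> Weyl, P = \sum_(k < m) wmul (Q k) (L k).

(* principal symbol w.r.t. the order filtration: the top-order part in d,
   read as an element of C[x][xi] *)
Definition psymbol (P : Weyl) : Weyl :=
  \sum_(b <- msupp P | mdeg b == (msize P).-1) P@_b *: 'X_[b].

Definition initial_ideal (I : Weyl -> Prop) (s : Weyl) : Prop :=
  exists2 P, I P & s = psymbol P.

Definition Cx := {fraction Xpoly}.
Definition Cxxi := {mpoly Cx[m]}.
Definition to_Cxxi (s : Weyl) : Cxxi := map_mpoly (fun q : Xpoly => @FracField.tofrac Xpoly q) s.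

Definition ext_ideal (I : Weyl -> Prop) (f : Cxxi) : Prop :=
  exists n (g : 'I_n -> Cxxi) (s : 'I_n -> Weyl),
    (forall i, initial_ideal I (s i)) /\ f = \sum_(i < n) g i * to_Cxxi (s i).

(* rank(I) = r :  dim_{C(x)} C(x)[xi] / (C(x)[xi] in(I)) = r, i.e. there are
   r elements whose classes form a C(x)-basis of the quotient. *)
Definition has_rank (I : Weyl -> Prop) (r : nat) : Prop :=
  exists v : 'I_r -> Cxxi,
    (forall c : 'I_r -> Cx,
        ext_ideal I (\sum_(i < r) c i *: v i) -> forall i, c i = 0)
    /\ (forall f : Cxxi, exists c : 'I_r -> Cx,
          ext_ideal I (f - \sum_(i < r) c i *: v i)).

End Weyl.

Definition is_int (C : ringType) (z : C) : Prop := exists n : int, z = n%:~R.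

(* Main.v *)
Require Import Defs.
From HB Require Import structures.
From mathcomp Require Import all_boot all_order all_algebra.
From mathcomp Require Import ssrcomplements mpoly complex reals.
Set Implicit Arguments. Unset Strict Implicit. Unset Printing Implicit Defensive.
Import Order.TTheory GRing.Theory Num.Theory.
Local Open Scope ring_scope.

(* With theta_k = x_k d_k and theta = sum_k theta_k, write l_k = P_k - x_k Q,
   where P_k is a polynomial in theta_k and Q one in theta.  The l_k commute:
   P_j commutes with P_k, Q and x_k for j <> k, and Q x_k = x_k Q(theta + 1)
   makes (x_j Q)(x_k Q) symmetric in j and k.  The symbols are
   s_k = y_k^p - x_k (sum_j y_j)^p with y_k = x_k xi_k; since they become y_k^p
   at x = 0 (for y fixed), the products
     v_g = prod_k y_k^(g_k mod p) s_k^(g_k div p)   (g in N^m)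
   form a C(x)-basis of C(x)[xi].  They are the symbols of the operators
     V_g = prod_k theta_k^(g_k mod p) prod_k l_k^(g_k div p),
   and V_g l_k = V_(g + p e_k) because the l_k commute.  So, up to denominators,
   the left ideal is spanned by the V_g with some g_k >= p, its initial ideal by
   the corresponding v_g, and the remaining p^m elements v_g are a basis of the
   quotient. *)

(** * Multi-indices and linear combinations indexed by them *)

Lemma mnm_ind n (P : 'X_{1..n} -> Prop) :
  P 0%MM -> (forall b j, P b -> P (b + U_(j))%MM) -> forall b, P b.
Proof.
move=> P0 PS b; have [d] := ubnP (mdeg b); elim: d b => // d IHd b /ltnSE led.
have [->//|b0] := eqVneq b 0%MM.
have [j bj] : exists j, b j != 0%N.
  apply/existsP; apply: contraNT b0; rewrite negb_exists => /forallP b0.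
  by apply/eqP/mnmP => j; rewrite mnm0E; apply/eqP; rewrite -[_ == _]negbK b0.
have lejb : (U_(j) <= b)%MM by rewrite lep1mP.
rewrite -(submK lejb); apply/PS/IHd.
by rewrite -{1}(submK lejb) mdegD mdeg1 addn1 in led.
Qed.

(** The index [j] occurs exactly once in [s], and since the maps commute its extra application can
    be pulled out to the front. This gives the rule d^(b + e_j) = d_j d^b for products of commuting
    operators. *)
Lemma foldr_iterS (T : Type) (I : eqType) (f : I -> T -> T) (c b : I -> nat)
    (x : T) (s : seq I) (j : I) :
  (forall i k y, f i (f k y) = f k (f i y)) -> uniq s -> j \in s ->
  (forall i, c i = b i + (j == i))%N ->
  foldr (fun i y => iter (c i) (f i) y) x s =
    f j (foldr (fun i y => iter (b i) (f i) y) x s).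
Proof.
move=> fC us js cb; have iterC i t y : iter t (f i) (f j y) = f j (iter t (f i) y).
  by elim: t => //= t ->; rewrite fC.
elim: s us js => //= i s IHs /andP[inotins us]; rewrite inE cb.
have [eji|nij] := eqVneq j i => /= js; first subst i.
  rewrite addn1 /=; congr (f _ (iter _ _ _)).
  elim: s inotins {IHs us js} => //= i s IHs; rewrite inE negb_or.
  by case/andP=> /negPf ji /IHs ->; rewrite cb ji addn0.
by rewrite addn0 IHs ?iterC.
Qed.

Section LinComb.
Variables (A : comNzRingType) (n : nat) (V : lmodType A) (F : 'X_{1..n} -> V).
Implicit Types c : {mpoly A[n]}.

(** The coefficient vector is encoded as a polynomial, so that shifting the index of [F] by a fixed
    multi-index amounts to multiplying [c] by a monomial. *)
Definition lincomb c : V := \sum_(b <- msupp c) c@_b *: F b.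

Lemma lincombwE N c : (msize c <= N)%N ->
  lincomb c = \sum_(b : 'X_{1..n < N}) c@_b *: F b.
Proof.
move=> lt_cN; pose I := 'X_{1..n < N}.
rewrite /lincomb (big_mksub I) //=; first last.
- by move=> x /msize_mdeg_lt /leq_trans; apply.
- by rewrite msupp_uniq.
rewrite big_rmcond //= => b; rewrite -mcoeff_eq0 => /eqP ->.
by rewrite scale0r.
Qed.

Lemma lincomb_is_linear : linear lincomb.
Proof.
move=> a c d; pose N := maxn (msize (a *: c + d)) (maxn (msize c) (msize d)).
rewrite !(@lincombwE N) ?leq_maxl ?leq_max ?leqnn ?orbT // scaler_sumr -big_split /=.
by apply: eq_bigr => b _; rewrite mcoeffD mcoeffZ scalerDl scalerA.
Qed.

HB.instance Definition _ := GRing.isLinear.Build A {mpoly A[n]} V *:%R lincomb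
  lincomb_is_linear.

Lemma lincombX b : lincomb 'X_[b] = F b.
Proof. by rewrite /lincomb msuppX big_seq1 mcoeffX eqxx scale1r. Qed.

End LinComb.

Lemma mpoly_addind (A : nzRingType) n (T : {mpoly A[n]} -> Prop) :
  T 0 -> (forall a b P, T P -> T (a *: 'X_[b] + P)) -> forall P, T P.
Proof.
move=> T0 TD P; rewrite (mpolyE P).
by elim: (msupp P) => [|b s IHs]; rewrite ?big_nil ?big_cons //; apply: TD.
Qed.

(** * The ring of normally ordered differential operators *)

Record derivations (A : comNzRingType) (n : nat) := Derivations {
  der :> 'I_n -> A -> A;
  derB : forall j, additive (der j);
  derM : forall j a b, der j (a * b) = der j a * b + a * der j b;
  derC : forall i j a, der i (der j a) = der j (der i a)
}.

HB.instance Definition _ (A : comNzRingType) n (D : derivations A n) j :=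
  GRing.isAdditive.Build A A (D j) (derB D j).

Lemma der1 (A : comNzRingType) n (D : derivations A n) j : D j 1 = 0.
Proof. by apply: (addrI (D j 1)); rewrite addr0 -{3}[1]mulr1 derM mulr1 mul1r. Qed.

Section NormallyOrdered.
Variables (A : comNzRingType) (n : nat) (D : derivations A n).
Implicit Types (P Q : {mpoly A[n]}) (a : A) (i j k : 'I_n) (b : 'X_{1..n}).

(** [lder], [lderm] and [dmult] copy the shape of [dmul], [dpow] and [wmul], so that for A = C[x]
    with the partial derivatives they agree by conversion. *)
Definition lder j Q : {mpoly A[n]} := Q * 'X_j + map_mpoly (D j) Q.

Definition lderm b Q : {mpoly A[n]} :=
  foldr (fun j Q' => iter (b j) (lder j) Q') Q (enum 'I_n).

Definition dmult P Q : {mpoly A[n]} := lincomb (fun b => lderm b Q) P.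

Lemma lder_is_additive j : additive (lder j).
Proof. by move=> P Q; rewrite /lder mulrBl raddfB /= opprD addrACA. Qed.

HB.instance Definition _ j :=
  GRing.isAdditive.Build {mpoly A[n]} {mpoly A[n]} (lder j) (lder_is_additive j).

Lemma lderD j P Q : lder j (P + Q) = lder j P + lder j Q.
Proof. exact: raddfD. Qed.

Lemma lderZ j a Q : lder j (a *: Q) = a *: lder j Q + D j a *: Q.
Proof.
have -> : lder j (a *: Q) = a *: (Q * 'X_j) + map_mpoly (D j) (a *: Q).
  by rewrite /lder scalerAl.
rewrite scalerDr -addrA; congr (_ + _); apply/mpolyP => b.
by rewrite mcoeffD !mcoeffZ !mcoeff_map_mpoly mcoeffZ /= derM addrC.
Qed.

Lemma lderX j b : lder j 'X_[b] = 'X_[b + U_(j)].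
Proof.
rewrite /lder mpolyXD -[RHS]addr0; congr (_ + _); apply/mpolyP => d.
rewrite mcoeff_map_mpoly mcoeffX mcoeff0.
by case: eqP => _; rewrite ?raddf0 // /= der1.
Qed.

(** On a term a d^b either order yields a d^(b+e_i+e_j), (D_i a) d^(b+e_j), (D_j a) d^(b+e_i) and
    (D_i D_j a) d^b, a sum symmetric in i and j by [derC]. *)
Lemma lderC i j Q : lder i (lder j Q) = lder j (lder i Q).
Proof.
elim/mpoly_addind: Q => [|a b Q IHQ]; first by rewrite !raddf0.
have monE i' j' : lder i' (lder j' (a *: 'X_[b])) =
    (a *: 'X_[b + U_(j') + U_(i')] + D i' a *: 'X_[b + U_(j')])
    + (D j' a *: 'X_[b + U_(i')] + D i' (D j' a) *: 'X_[b]).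
  by rewrite lderZ lderX lderD 2!lderZ 2!lderX.
rewrite (lderD j (a *: _)) (lderD i (a *: _)) (lderD i (lder _ _)) (lderD j (lder _ _)).
rewrite {}IHQ 2!monE derC; congr (_ + _).
have -> : (b + U_(j) + U_(i) = b + U_(i) + U_(j))%MM.
  by rewrite -!addmA [(U_(i) + _)%MM]addmC.
exact: addrACA.
Qed.

Lemma lderm0 Q : lderm 0%MM Q = Q.
Proof. by rewrite /lderm; elim: (enum _) => //= j s ->; rewrite mnm0E. Qed.

Lemma ldermS b j Q : lderm (b + U_(j))%MM Q = lder j (lderm b Q).
Proof.
apply: foldr_iterS; [exact: lderC | exact: enum_uniq | exact: mem_enum | move=> i].
by rewrite mnmDE mnm1E.
Qed.

Lemma lderm_is_additive b : additive (lderm b).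
Proof.
elim/mnm_ind: b => [|b j IHb] P Q; first by rewrite !lderm0.
by rewrite !ldermS IHb raddfB.
Qed.

HB.instance Definition _ b :=
  GRing.isAdditive.Build {mpoly A[n]} {mpoly A[n]} (lderm b) (lderm_is_additive b).

Lemma ldermX b d : lderm b 'X_[d] = 'X_[b + d].
Proof.
elim/mnm_ind: b => [|b j IHb]; first by rewrite lderm0 add0m.
by rewrite ldermS IHb lderX -addmA [(d + _)%MM]addmC addmA.
Qed.

Lemma lderm_constZ b a Q : (forall j, D j a = 0) -> lderm b (a *: Q) = a *: lderm b Q.
Proof.
move=> Da; elim/mnm_ind: b => [|b j IHb]; first by rewrite !lderm0.
by rewrite !ldermS IHb lderZ Da scale0r addr0.
Qed.

Lemma dmultDl : left_distributive dmult +%R.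
Proof. by move=> P P' Q; rewrite /dmult linearD. Qed.

Lemma dmultZl a P Q : dmult (a *: P) Q = a *: dmult P Q.
Proof. by rewrite /dmult linearZ. Qed.

Lemma dmultXl b Q : dmult 'X_[b] Q = lderm b Q.
Proof. by rewrite /dmult lincombX. Qed.

Lemma dmultDr : right_distributive dmult +%R.
Proof.
move=> P Q Q'; rewrite /dmult /lincomb -big_split /=; apply: eq_bigr => b _.
by rewrite -scalerDr raddfD.
Qed.

(** This is associativity for the left factor d_j: on a term a d^b of [P], both sides produce the
    same Leibniz term (D_j a) d^b Q. Iterating over j and using left linearity gives [dmultA]. *)
Lemma dmult_lder j P Q : dmult (lder j P) Q = lder j (dmult P Q).
Proof.
elim/mpoly_addind: P => [|a b P IHP]; first by rewrite /dmult !raddf0.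
rewrite raddfD /= [LHS]dmultDl IHP (dmultDl (_ *: _)) raddfD /=; congr (_ + _).
by rewrite lderZ dmultDl lderX !dmultZl !dmultXl lderZ ldermS.
Qed.

Lemma dmult_lderm b P Q : dmult (lderm b P) Q = lderm b (dmult P Q).
Proof.
elim/mnm_ind: b => [|b j IHb]; first by rewrite !lderm0.
by rewrite !ldermS dmult_lder IHb.
Qed.

Lemma dmultA : associative dmult.
Proof.
move=> P Q T; elim/mpoly_addind: P => [|a b P IHP]; first by rewrite /dmult !raddf0.
by rewrite !dmultDl IHP !dmultZl !dmultXl dmult_lderm.
Qed.

Lemma dmult1l : left_id 1 dmult.
Proof. by move=> P; rewrite -mpolyX0 dmultXl lderm0. Qed.

Lemma dmult1r : right_id 1 dmult.
Proof.
move=> P; rewrite /dmult /lincomb [RHS]mpolyE; apply: eq_bigr => b _.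
by rewrite -mpolyX0 ldermX addm0.
Qed.

Lemma dmult_constr P a : (forall j, D j a = 0) -> dmult P a%:MP = a *: P.
Proof.
move=> Da; rewrite /dmult /lincomb -alg_mpolyC [in RHS](mpolyE P) scaler_sumr.
apply: eq_bigr => b _; rewrite lderm_constZ // -mpolyX0 ldermX addm0 !scalerA.
by rewrite mulrC.
Qed.

Lemma dmultCl a Q : dmult a%:MP Q = a *: Q.
Proof. by rewrite -alg_mpolyC dmultZl dmult1l. Qed.

End NormallyOrdered.

(* A copy of the module of normally ordered operators whose ring product is the
   composition of operators instead of the product of symbols. *)
Definition DiffOp (A : comNzRingType) n (D : derivations A n) := {mpoly A[n]}.

HB.instance Definition _ (A : comNzRingType) n (D : derivations A n) :=
  GRing.Zmodule.copy (DiffOp D) {mpoly A[n]}.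

HB.instance Definition _ (A : comNzRingType) n (D : derivations A n) :=
  GRing.Zmodule_isNzRing.Build (DiffOp D) (@dmultA A n D) (@dmult1l A n D)
    (@dmult1r A n D) (@dmultDl A n D) (@dmultDr A n D) (oner_neq0 {mpoly A[n]}).

(** * Commutation of the operators l_k, from the relations between theta_k and x_k *)

Section RingEll.
Variables (S : pzRingType) (m p : nat) (t x : 'I_m -> S).
Variables (a : 'I_p -> S) (b : 'I_p -> 'I_m -> S).
Hypothesis tC : forall j k, GRing.comm (t j) (t k).
Hypothesis xC : forall j k, GRing.comm (x j) (x k).
Hypothesis txC : forall j k, j != k -> GRing.comm (t j) (x k).
Hypothesis tx : forall k, t k * x k = x k * (t k + 1).
Hypothesis aC : forall i y, GRing.comm (a i) y.
Hypothesis bC : forall i k y, GRing.comm (b i k) y.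

(** Here [t] and [x] stand for theta_k and x_k, and [b i k] for the shifted parameter b_{i,k} -
    1. *)
Definition ring_ell k : S :=
  \prod_(i < p) (t k + b i k) - x k * \prod_(i < p) (\sum_j t j + a i).

(** Among the summands only [t k] fails to commute with [x k], and it contributes the 1. *)
Lemma theta_shift k c : GRing.comm c (x k) ->
  (\sum_j t j + c) * x k = x k * (\sum_j t j + c + 1).
Proof.
move=> cC; have -> : \sum_j t j + c + 1 = \sum_j t j + 1 + c by rewrite addrAC.
rewrite mulrDl mulrDr cC; congr (_ + _).
rewrite (bigD1 k) //= mulrDl tx !mulrDr mulr1 addrAC -!addrA; congr (_ + (_ + _)).
by rewrite mulr_suml mulr_sumr; apply: eq_bigr => j /txC.
Qed.

Lemma ring_ell_comm j k : GRing.comm (ring_ell j) (ring_ell k).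
Proof.
pose Q := \prod_(i < p) (\sum_l t l + a i).
pose Q1 := \prod_(i < p) (\sum_l t l + a i + 1).
pose P l := \prod_(i < p) (t l + b i l).
have [->//|njk] := eqVneq j k.
have Qx l : Q * x l = x l * Q1.
  rewrite /Q /Q1; elim/big_rec2: _ => [|i y1 y2 _ IH]; first by rewrite mulr1 mul1r.
  by rewrite -mulrA IH mulrA theta_shift ?mulrA //; apply: aC.
have tCP l y : GRing.comm y (t l) -> GRing.comm y (P l).
  move=> yt; apply: commr_prod => i _; apply: commrD => //.
  exact/commr_sym/bC.
have PQ l : GRing.comm (P l) Q.
  apply: commr_prod => i _; apply: commrD; last exact/commr_sym/aC.
  by apply: commr_sum => l' _; apply/commr_sym/tCP/tC.
have Px l l' : l != l' -> GRing.comm (P l) (x l').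
  by move=> nl; apply/commr_sym/tCP/commr_sym/txC.
have PP : GRing.comm (P j) (P k) by apply: (tCP); apply/commr_sym/tCP/tC.
(* Moving [Q] past the second variable turns both products into x_j x_k Q1 Q. *)
have xQxQ : GRing.comm (x j * Q) (x k * Q).
  by rewrite /GRing.comm -!mulrA ![Q * (_ * _)]mulrA !Qx !mulrA xC.
rewrite /ring_ell -/Q -/(P j) -/(P k); apply: commrB; apply/commr_sym/commrB.
- exact/commr_sym.
- by apply/commrM; [apply: Px; rewrite eq_sym | apply: PQ].
- by apply/commr_sym/commrM; [apply: Px | apply: PQ].
- exact/commr_sym.
Qed.

End RingEll.

(** * Order filtration and leading parts *)

Section Order.
Variables (A : comNzRingType) (n : nat) (D : derivations A n).
Implicit Types (P Q f g : {mpoly A[n]}) (d e : nat).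

Lemma msize_leP d f : (forall b, b \in msupp f -> (mdeg b < d)%N) -> (msize f <= d)%N.
Proof. by move=> fd; rewrite msizeE; apply/bigmax_leqP_seq => b /fd. Qed.

Lemma msize_mul_le d e f g :
  (msize f <= d.+1)%N -> (msize g <= e)%N -> (msize (f * g) <= d + e)%N.
Proof.
move=> fd ge; apply: msize_leP => b /msuppM_le /allpairsP[[b1 b2] /= [b1f b2g ->]].
rewrite mdegD -addnS leq_add //.
  by rewrite -ltnS (leq_trans (msize_mdeg_lt b1f)).
by rewrite (leq_trans (msize_mdeg_lt b2g)).
Qed.

Lemma msizeD_leq d f g :
  (msize f <= d)%N -> (msize g <= d)%N -> (msize (f + g) <= d)%N.
Proof. by move=> fd gd; rewrite (leq_trans (msizeD_le _ _)) // geq_max fd. Qed.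

Lemma msize_map_der j f : (msize (map_mpoly (D j) f) <= msize f)%N.
Proof.
apply: msize_leP => b; rewrite mcoeff_msupp mcoeff_map_mpoly /= => Db.
apply: msize_mdeg_lt; rewrite mcoeff_msupp; apply: contraNneq Db => ->.
by rewrite raddf0.
Qed.

(** Each d_j acts as multiplication by its symbol plus a derivative of the coefficients, and the
    latter does not raise the order. *)
Lemma msize_lderm d b Q : (msize Q <= d.+1)%N ->
  (msize (lderm D b Q - 'X_[b] * Q) <= d + mdeg b)%N.
Proof.
move=> Qd; elim/mnm_ind: b => [|b j IHb].
  by rewrite lderm0 mpolyX0 mul1r subrr msize0.
have szb : (msize (lderm D b Q) <= (d + mdeg b).+1)%N.
  rewrite -(subrK ('X_[b] * Q) (lderm D b Q)); apply: msizeD_leq.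
    exact: leqW.
  by rewrite -addSn addnC; apply: msize_mul_le; rewrite // msizeX.
rewrite ldermS mdegD mdeg1 addnA addn1.
have -> : lder D j (lderm D b Q) - 'X_[b + U_(j)] * Q
    = 'X_j * (lderm D b Q - 'X_[b] * Q) + map_mpoly (D j) (lderm D b Q).
  rewrite /lder mpolyXD mulrBr addrAC [_ * 'X_j]mulrC; congr (_ - _ + _).
  by rewrite mulrCA mulrA.
apply: msizeD_leq; last by rewrite (leq_trans (msize_map_der _ _)).
by rewrite -add1n; apply: msize_mul_le; rewrite // msizeX mdeg1.
Qed.

(** As [msize] is the degree plus one, this says that [P] and [f] have order at most d and agree
    modulo order below d. Since [f] may vanish or have lower degree, the relation survives sums in
    which leading terms cancel. *)
Definition leading d P f := ((msize (P - f) <= d) && (msize f <= d.+1))%N.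

Lemma leading_msize d P f : leading d P f -> (msize P <= d.+1)%N.
Proof. by case/andP=> Pf fd; rewrite -(subrK f P) msizeD_leq // leqW. Qed.

Lemma leading_dmult d e P Q f g :
  leading d P f -> leading e Q g -> leading (d + e) (dmult D P Q) (f * g).
Proof.
move=> Pf Qg; have Pd := leading_msize Pf; have Qe := leading_msize Qg.
case/andP: Pf Qg => Pf fd /andP[Qg ge]; apply/andP; split; last first.
  by rewrite -addnS msize_mul_le.
(* The error splits into composition against the commutative product, then the replacement of P by
   f, then that of Q by g; each has order below d + e. *)
have -> : dmult D P Q - f * g
    = (dmult D P Q - P * Q) + ((P - f) * Q + f * (Q - g)).
  by rewrite mulrBl mulrBr !addrA !subrK.
apply: msizeD_leq; last apply: msizeD_leq.
- have -> : dmult D P Q - P * Q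
      = \sum_(b <- msupp P) P@_b *: (lderm D b Q - 'X_[b] * Q).
    rewrite {2}(mpolyE P) mulr_suml -sumrB; apply: eq_bigr => b _.
    by rewrite scalerBr scalerAl.
  rewrite (leq_trans (msize_sum _ _ _)) //; apply/bigmax_leqP_seq => b bP _.
  rewrite (leq_trans (mmeasureZ_le _ _ _)) // (leq_trans (msize_lderm _ Qe)) //.
  by rewrite addnC leq_add2r -ltnS (leq_trans (msize_mdeg_lt bP)).
- by rewrite mulrC addnC msize_mul_le.
- exact: msize_mul_le.
Qed.

Lemma leadingD d P Q f g :
  leading d P f -> leading d Q g -> leading d (P + Q) (f + g).
Proof.
case/andP=> Pf fd /andP[Qg gd]; apply/andP; split; last exact: msizeD_leq.
by rewrite opprD addrACA msizeD_leq.
Qed.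

Lemma leadingN d P f : leading d P f -> leading d (- P) (- f).
Proof. by case/andP=> Pf fd; rewrite /leading -opprD !msizeN Pf. Qed.

Lemma leading_refl d f : (msize f <= d.+1)%N -> leading d f f.
Proof. by move=> fd; rewrite /leading subrr msize0. Qed.

Lemma leading_lower d P : (msize P <= d)%N -> leading d P 0.
Proof. by move=> Pd; rewrite /leading subr0 Pd msize0. Qed.

Lemma leading_sum d I (r : seq I) (F G : I -> {mpoly A[n]}) :
  (forall i, leading d (F i) (G i)) ->
  leading d (\sum_(i <- r) F i) (\sum_(i <- r) G i).
Proof.
move=> FG; elim/big_rec2: _ => [|i P f _ IH]; last exact: leadingD.
by apply: leading_refl; rewrite msize0.
Qed.

Lemma leading_prod I (r : seq I) (d : I -> nat) (F : I -> DiffOp D)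
    (G : I -> {mpoly A[n]}) :
  (forall i, leading (d i) (F i) (G i)) ->
  leading (\sum_(i <- r) d i) (\prod_(i <- r) F i) (\prod_(i <- r) G i).
Proof.
move=> FG; elim: r => [|i r IHr]; last by rewrite !big_cons; apply: leading_dmult.
by rewrite !big_nil; apply: leading_refl; rewrite msize1.
Qed.

Lemma leading_exp d (F : DiffOp D) (G : {mpoly A[n]}) t :
  leading d F G -> leading (d * t) (F ^+ t) (G ^+ t).
Proof.
move=> FG; elim: t => [|t IHt].
  by rewrite muln0; apply: leading_refl; rewrite msize1.
by rewrite mulnS !exprS; apply: leading_dmult.
Qed.

End Order.

(** * Families of polynomials with non-singular coefficient matrices *)

Definition bmnm_val n N (i : 'I_#|{: 'X_{1..n < N}}|) : 'X_{1..n} :=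
  val (enum_val i : 'X_{1..n < N}).

Lemma bmnm_val_rank n N g (gN : (mdeg g < N)%N) :
  bmnm_val (@enum_rank 'X_{1..n < N} (BMultinom gN)) = g.
Proof. by rewrite /bmnm_val enum_rankK. Qed.

Lemma mdeg_bmnm_val n N (i : 'I_#|{: 'X_{1..n < N}}|) : (mdeg (bmnm_val i) < N)%N.
Proof. exact: bmdeg. Qed.

Lemma bmnm_val_inj n N : injective (@bmnm_val n N).
Proof. by move=> i j /val_inj/enum_val_inj. Qed.

Lemma big_bmnm_val n N (V : nmodType) (F : 'X_{1..n} -> V) :
  \sum_(b : 'X_{1..n < N}) F b = \sum_i F (@bmnm_val n N i).
Proof. by rewrite (reindex _ (onW_bij _ (enum_val_bij _))). Qed.

Lemma prod_expr_eq (S : pzSemiRingType) (I : finType) (F : I -> S) (k : I) :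
  \prod_i F i ^+ (k == i) = F k.
Proof.
transitivity (\prod_(i | i == k) F i); last by rewrite big_pred1_eq.
by rewrite [RHS]big_mkcond; apply: eq_bigr => i _; rewrite eq_sym; case: eqP.
Qed.

Section Family.
Variables (A : idomainType) (n : nat) (v : 'X_{1..n} -> {mpoly A[n]}).

(** Under [v_size], the members of index degree below N involve only monomials of degree below N, so
    this square matrix records them entirely. *)
Definition coeff_mx N : 'M[A]_#|{: 'X_{1..n < N}}| :=
  \matrix_(i, j) (v (bmnm_val i))@_(bmnm_val j).

Hypothesis v_size : forall g, (msize (v g) <= (mdeg g).+1)%N.
Hypothesis v_det : forall N, \det (coeff_mx N) != 0.

(** The coefficients of [c] form a row killed by the matrix. Multiplying by the adjugate leaves the
    determinant times the row, and the determinant cancels in a domain. *)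
Lemma lincomb_inj c : lincomb v c = 0 -> c = 0.
Proof.
move=> c0; pose N := msize c; pose r := \row_(i < #|{: 'X_{1..n < N}}|) c@_(bmnm_val i).
have rM : r *m coeff_mx N = 0.
  apply/rowP => j; rewrite !mxE -[RHS](mcoeff0 _ (bmnm_val j)) -c0 (lincombwE _ (leqnn N)).
  rewrite raddf_sum /= (big_bmnm_val N (fun b => (c@_b *: v b)@_(bmnm_val j))).
  apply: eq_bigr => i _.
  by rewrite !mxE mcoeffZ.
have := congr1 (mulmx^~ (\adj (coeff_mx N))) rM.
rewrite mul0mx -mulmxA mul_mx_adj mul_mx_scalar => r0.
apply/mpolyP => g; rewrite mcoeff0; have [gN|] := ltnP (mdeg g) N; last first.
  by move/msize_mdeg_ge; exact: memN_msupp_eq0.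
move/rowP: r0 => /(_ (@enum_rank 'X_{1..n < N} (BMultinom gN))).
rewrite !mxE bmnm_val_rank => /eqP.
by rewrite mulf_eq0 (negPf (v_det N)) => /eqP.
Qed.

(** Cramer's rule: the adjugate solves the system up to the determinant, so no fractions are needed.
    The bound on [msize c] keeps track of the order in later inductions. *)
Lemma lincomb_surj N f : (msize f <= N)%N ->
  exists2 c, (msize c <= N)%N & lincomb v c = \det (coeff_mx N) *: f.
Proof.
move=> fN; pose r := (\row_(i < #|{: 'X_{1..n < N}}|) f@_(bmnm_val i)) *m \adj (coeff_mx N).
exists (\sum_i r 0 i *: 'X_[bmnm_val i]).
  rewrite (leq_trans (msize_sum _ _ _)) //; apply/bigmax_leqP => i _.
  by rewrite (leq_trans (mmeasureZ_le _ _ _)) // msizeX mdeg_bmnm_val.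
rewrite linear_sum /=; apply/mpolyP => g; rewrite raddf_sum mcoeffZ /=.
have [gN|] := ltnP (mdeg g) N; last first.
  move=> Ng; rewrite big1 => [|i _].
    by rewrite (memN_msupp_eq0 (msize_mdeg_ge (leq_trans fN Ng))) mulr0.
  rewrite linearZ /= lincombX mcoeffZ memN_msupp_eq0 ?mulr0 //.
  by apply: msize_mdeg_ge; rewrite (leq_trans (v_size _)) // (leq_trans (mdeg_bmnm_val _)).
pose j := @enum_rank 'X_{1..n < N} (BMultinom gN).
transitivity ((r *m coeff_mx N) 0 j).
  rewrite [RHS]mxE; apply: eq_bigr => i _.
  by rewrite linearZ /= lincombX mcoeffZ [coeff_mx _ _ _]mxE /j bmnm_val_rank.
by rewrite -mulmxA mul_adj_mx mul_mx_scalar !mxE /j bmnm_val_rank.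
Qed.

End Family.

Lemma lincomb_map (A B : comNzRingType) n (f : {rmorphism A -> B})
    (v : 'X_{1..n} -> {mpoly A[n]}) c :
  injective f ->
  lincomb (fun g => map_mpoly f (v g)) (map_mpoly f c) = map_mpoly f (lincomb v c).
Proof.
move=> f_inj; rewrite (@lincombwE _ _ _ _ (msize c)); last first.
  apply: msize_leP => b; rewrite mcoeff_msupp mcoeff_map_mpoly => fb.
  by apply: msize_mdeg_lt; rewrite mcoeff_msupp; apply: contraNneq fb => ->; rewrite raddf0.
rewrite (lincombwE _ (leqnn (msize c))) raddf_sum; apply: eq_bigr => b _.
by rewrite mcoeff_map_mpoly /= map_mpolyZ.
Qed.

Lemma coeff_mx_map (A B : idomainType) n (f : {rmorphism A -> B})
    (v : 'X_{1..n} -> {mpoly A[n]}) N :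
  coeff_mx (fun g => map_mpoly f (v g)) N = map_mx f (coeff_mx v N).
Proof. by apply/matrixP => i j; rewrite !mxE mcoeff_map_mpoly. Qed.

(** * The symbols s_k and v_g, and their independence *)

Section Symbols.
Variables (A : idomainType) (m p : nat) (x : 'I_m -> A).
Implicit Types (g : 'X_{1..m}) (k : 'I_m) (f : {mpoly A[m]}).
Local Notation AX := {mpoly A[m]}.

Definition sym_theta k : AX := x k *: 'X_k.

Definition sym_ell k : AX := sym_theta k ^+ p - x k *: (\sum_j sym_theta j) ^+ p.

Definition sym_basis g : AX :=
  \prod_k (sym_theta k ^+ (g k %% p) * sym_ell k ^+ (g k %/ p)).

Lemma sym_theta_homog k : sym_theta k \is 1.-homog.
Proof. by rewrite /sym_theta dhomogZ // dhomogX /= mdeg1. Qed.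

Lemma sym_ell_homog k : sym_ell k \is p.-homog.
Proof.
have hX (u : AX) : u \is 1.-homog -> u ^+ p \is p.-homog.
  by move/(dhomogMn p); rewrite mul1n.
apply: rpredB; first exact/hX/sym_theta_homog.
by apply: dhomogZ; apply: hX; apply: rpred_sum => j _; apply: sym_theta_homog.
Qed.

Lemma sym_basis_homog g : sym_basis g \is (mdeg g).-homog.
Proof.
rewrite mdegE /sym_basis; elim/big_rec2: _ => [|k f d _ fd]; first exact: dhomog1.
apply: dhomogM => //.
suff: sym_theta k ^+ (g k %% p) * sym_ell k ^+ (g k %/ p)
    \is (1 * (g k %% p) + p * (g k %/ p)).-homog.
  by rewrite mul1n [(p * _)%N]mulnC addnC -divn_eq.
apply: dhomogM; apply: dhomogMn; [exact: sym_theta_homog | exact: sym_ell_homog].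
Qed.

Lemma sym_basis_size g : (msize (sym_basis g) <= (mdeg g).+1)%N.
Proof.
by apply: msize_leP => b bg; rewrite (dhomog_mf (sym_basis_homog g) bg).
Qed.

Lemma divn_addU g k i : (0 < p)%N ->
  (((g + U_(k) *+ p)%MM i %/ p) = g i %/ p + (k == i))%N.
Proof.
move=> p0; rewrite mnmDE mulmnE mnm1E; case: (k == i); last by rewrite mul0n !addn0.
by rewrite mul1n divnDr ?dvdnn // divnn p0.
Qed.

Lemma modn_addU g k i : ((g + U_(k) *+ p)%MM i %% p = g i %% p)%N.
Proof. by rewrite mnmDE mulmnE addnC modnMDl. Qed.

Lemma sym_basisS g k : (0 < p)%N ->
  sym_basis (g + U_(k) *+ p)%MM = sym_basis g * sym_ell k.
Proof.
move=> p0; rewrite /sym_basis -[sym_ell k](prod_expr_eq sym_ell) -big_split /=.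
by apply: eq_bigr => i _; rewrite modn_addU divn_addU // exprD mulrA.
Qed.

(** These are the v_g with y_k taken as the variables. Unlike the v_g in terms of xi, they stay
    independent when x is set to 0; [rescale] substitutes y_k = x_k xi_k. *)
Definition sym_basis0 g : AX :=
  \prod_k ('X_k ^+ (g k %% p) *
            ('X_k ^+ p - x k *: (\sum_j 'X_j) ^+ p) ^+ (g k %/ p)).

Definition rescale (f : AX) : AX := f \mPo [tuple sym_theta k | k < m].

HB.instance Definition _ := GRing.RMorphism.copy rescale
  (@comp_mpoly m A m [tuple sym_theta k | k < m]).

Lemma rescaleX k : rescale 'X_k = sym_theta k.
Proof. by rewrite /rescale comp_mpolyXU -tnth_nth tnth_mktuple. Qed.

Lemma rescaleZ a f : rescale (a *: f) = a *: rescale f.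
Proof. exact: comp_mpolyZ. Qed.

Lemma sym_basis_rescale g : sym_basis g = rescale (sym_basis0 g).
Proof.
rewrite rmorph_prod; apply: eq_bigr => k _.
rewrite rmorphM !rmorphXn /= rescaleX; congr (_ * _ ^+ _).
rewrite rmorphB /= rescaleZ !rmorphXn /= rescaleX rmorph_sum /sym_ell /=.
by under [in RHS]eq_bigr => j _ do rewrite rescaleX.
Qed.

Lemma mcoeff_rescale f g : (rescale f)@_g = (\prod_k x k ^+ g k) * f@_g.
Proof.
have rX b : rescale 'X_[b] = (\prod_k x k ^+ b k) *: 'X_[b].
  rewrite /rescale comp_mpolyX [in RHS]mpolyXE_id -scaler_prod.
  by apply: eq_bigr => k _; rewrite tnth_mktuple exprZn.
elim/mpoly_addind: f => [|a b f IHf]; first by rewrite rmorph0 !mcoeff0 mulr0.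
rewrite rmorphD /= rescaleZ rX !mcoeffD IHf mulrDr !mcoeffZ mcoeffX; congr (_ + _).
by case: eqP => [->|_]; rewrite ?mulr0 // !mulr1 mulrC.
Qed.

(** The substitution y_k = x_k xi_k multiplies each monomial by a power product of the x_k, which
    scales the columns. *)
Lemma coeff_mx_sym_basis N :
  coeff_mx sym_basis N =
    coeff_mx sym_basis0 N *m diag_mx (\row_i \prod_k x k ^+ bmnm_val i k).
Proof.
apply/matrixP => i j; rewrite [LHS]mxE sym_basis_rescale mcoeff_rescale mulrC.
by rewrite mul_mx_diag [RHS]mxE; congr (_ * _); rewrite mxE.
Qed.

(* At the point x = 0 the symbols of the operators become the p-th powers of the
   variables, so that [sym_basis0] specializes to the monomial basis. *)
Lemma det_sym_basis (F : comNzRingType) (ev : {rmorphism A -> F}) N :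
  (forall k, ev (x k) = 0) -> (forall k, x k != 0) ->
  \det (coeff_mx sym_basis N) != 0.
Proof.
move=> ev0 x0; rewrite coeff_mx_sym_basis det_mulmx det_diag mulf_neq0 //; last first.
  apply/prodf_neq0 => i _; rewrite mxE; apply/prodf_neq0 => k _.
  exact: expf_neq0.
apply/eqP => /(congr1 ev); rewrite -det_map_mx rmorph0 => /eqP.
suff -> : map_mx ev (coeff_mx sym_basis0 N) = 1%:M by rewrite det1 oner_eq0.
apply/matrixP => i j; rewrite !mxE -mcoeff_map_mpoly rmorph_prod /=.
transitivity (('X_[bmnm_val i] : {mpoly F[m]})@_(bmnm_val j)); last first.
  by rewrite mcoeffX (inj_eq (@bmnm_val_inj _ _)).
congr mcoeff; rewrite mpolyXE_id; apply: eq_bigr => k _.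
rewrite rmorphM !rmorphXn /= rmorphB /= map_mpolyZ /= ev0 scale0r subr0 rmorphXn /=.
by rewrite map_mpolyX -exprM -exprD addnC mulnC -divn_eq.
Qed.

End Symbols.

(** * Principal symbols as top homogeneous components *)

Section TopPart.
Variables (A : comNzRingType) (n : nat).
Implicit Types (P q f : {mpoly A[n]}) (d : nat).

Definition top_part f : {mpoly A[n]} := pihomog mdeg (msize f).-1 f.

Lemma mcoeff_pihomog d f g :
  (pihomog mdeg d f)@_g = if mdeg g == d then f@_g else 0.
Proof.
elim/mpoly_addind: f => [|a b f IHf]; first by rewrite pihomog0 mcoeff0 if_same.
rewrite pihomogD linearZ /= pihomogX !mcoeffD IHf !mcoeffZ mcoeffX.
case: (eqVneq b g) => [<-|nbg].
  by case: ifP => _; rewrite ?mcoeffX ?eqxx ?mcoeff0 // mulr0 addr0.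
rewrite mulr0 add0r; case: (mdeg b == d); rewrite ?mcoeffX ?(negPf nbg) ?mcoeff0 //.
all: by rewrite mulr0 add0r.
Qed.

Lemma msize_sub_pihomog d f :
  (msize f <= d.+1)%N -> (msize (f - pihomog mdeg d f) <= d)%N.
Proof.
move=> fd; apply: msize_leP => g; rewrite mcoeff_msupp mcoeffB mcoeff_pihomog.
case: (eqVneq (mdeg g) d) => [_|gd]; first by rewrite subrr eqxx.
rewrite subr0 -mcoeff_msupp => /msize_mdeg_lt gf.
by rewrite ltn_neqAle gd -ltnS (leq_trans gf).
Qed.

Lemma pihomog_low d f : (msize f <= d)%N -> pihomog mdeg d f = 0.
Proof.
move=> fd; rewrite pihomogE big_seq_cond big1 // => b /andP[/msize_mdeg_lt bf /eqP bd].
by move: (leq_trans bf fd); rewrite bd ltnn.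
Qed.

(** Since [q] is non-zero and [P - q] has order below d, the order of [P] is exactly d; no
    cancellation can occur in degree d. *)
Lemma top_unique d P q :
  q \is d.-homog -> q != 0 -> (msize (P - q) <= d)%N -> top_part P = q.
Proof.
move=> qd q0 Pq; have qdE b : b \in msupp q -> mdeg b = d by apply: (dhomog_mf qd).
have Pd : msize P = d.+1.
  apply/eqP; rewrite eqn_leq; apply/andP; split.
    rewrite -(subrK q P); apply: msizeD_leq; first exact: leqW.
    by apply: msize_leP => b /qdE ->.
  have [b bq] : exists b, b \in msupp q.
    by case: (msupp q) (msupp_eq0 q) => [|b s]; [rewrite eqxx (negPf q0) | exists b; rewrite mem_head].
  rewrite -(qdE b bq); apply: msize_mdeg_lt; rewrite mcoeff_msupp -(subrK q P) mcoeffD.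
  rewrite (@memN_msupp_eq0 _ _ (P - q)) ?add0r -?mcoeff_msupp //.
  by apply: msize_mdeg_ge; rewrite qdE.
rewrite /top_part Pd -{1}(subrK q P) pihomogD (pihomog_low Pq) add0r.
exact: pihomog_dE.
Qed.

End TopPart.

Lemma topZ (A : idomainType) n (h : A) (P : {mpoly A[n]}) :
  h != 0 -> top_part (h *: P) = h *: top_part P.
Proof. by move=> h0; rewrite /top_part msizeZ // linearZ. Qed.

(** * Coefficient vectors supported outside the box of exponents below p *)

Section Reducible.
Variables (A : comNzRingType) (m p : nat).
Implicit Types c d : {mpoly A[m]}.

Definition reducible c := forall g, c@_g != 0 -> exists k, (p <= g k)%N.

Lemma reducible0 : reducible 0.
Proof. by move=> g; rewrite mcoeff0 eqxx. Qed.

Lemma reducibleD c d : reducible c -> reducible d -> reducible (c + d).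
Proof.
move=> rc rd g; rewrite mcoeffD; have [->|/rc//] := eqVneq c@_g 0.
by rewrite add0r => /rd.
Qed.

Lemma reducibleZ a c : reducible c -> reducible (a *: c).
Proof.
by move=> rc g; rewrite mcoeffZ => acg; apply: rc; apply: contraNneq acg => ->; rewrite mulr0.
Qed.

Lemma reducible_mulX c k : reducible (c * 'X_[U_(k) *+ p]).
Proof.
move=> g; rewrite -mcoeff_msupp => /msuppM_le /allpairsP[[b1 b2] /= [_ b2X ->]].
move: b2X; rewrite msuppX inE => /eqP ->; exists k.
by rewrite mnmDE mulmnE mnm1E eqxx mul1n leq_addl.
Qed.

Lemma reducible_pihomog (e : nat) c : reducible c -> reducible (pihomog mdeg e c).
Proof.
by move=> rc g; rewrite mcoeff_pihomog; case: ifP => [_ /rc //|_]; rewrite eqxx.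
Qed.

End Reducible.

(** * The operators V_g and the initial ideal *)

Section Operators.
Variables (A : idomainType) (m p : nat) (D : derivations A m).
Variables (x : 'I_m -> A) (a : 'I_p -> A) (b : 'I_p -> 'I_m -> A).
Hypothesis p_gt0 : (0 < p)%N.
Hypothesis Dx : forall j k, D j (x k) = (j == k)%:R.
Hypothesis Da : forall i j, D j (a i) = 0.
Hypothesis Db : forall i k j, D j (b i k) = 0.
Implicit Types (P Q c : {mpoly A[m]}) (g : 'X_{1..m}) (k : 'I_m).
Local Notation AX := {mpoly A[m]}.

Definition op_x k : DiffOp D := (x k)%:MP.
Definition op_theta k : DiffOp D := op_x k * ('X_k : AX).
Definition op_ell k : DiffOp D :=
  ring_ell op_theta op_x (fun i => (a i)%:MP) (fun i k => (b i k)%:MP) k.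
(** The l_k stand to the right of the theta_k, so that right multiplication by some l_k meets only
    factors commuting with it. *)
Definition op_basis g : AX :=
  (\prod_k op_theta k ^+ (g k %% p)) * (\prod_k op_ell k ^+ (g k %/ p)) : DiffOp D.

Lemma op_thetaE k : op_theta k = sym_theta x k.
Proof. exact: dmultCl. Qed.

Lemma op_const_comm (u : A) (P : DiffOp D) :
  (forall j, D j u = 0) -> GRing.comm (u%:MP : DiffOp D) P.
Proof.
move=> Du; transitivity (u *: (P : AX)); first exact: dmultCl.
by symmetry; apply: dmult_constr.
Qed.

Lemma op_x_comm j k : GRing.comm (op_x j) (op_x k).
Proof.
transitivity ((x j * x k)%:MP : AX).
  by rewrite [LHS]dmultCl -mul_mpolyC mpolyCM.
by rewrite [RHS]dmultCl -mul_mpolyC mulrC mpolyCM.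
Qed.

Lemma op_dx j k :
  ('X_j : DiffOp D) * op_x k = op_x k * ('X_j : DiffOp D) + (j == k)%:R%:MP.
Proof.
rewrite [LHS](dmultXl D) [X in X + _](dmultCl D) -(add0m U_(j)%MM) ldermS lderm0.
by rewrite /lder mul_mpolyC add0m map_mpolyC /= Dx.
Qed.

Lemma op_d_comm j k : GRing.comm ('X_j : DiffOp D) ('X_k : DiffOp D).
Proof. by rewrite /GRing.comm ![LHS](dmultXl D) ![RHS](dmultXl D) !ldermX addmC. Qed.

Lemma op_dx_comm j k : j != k -> GRing.comm ('X_j : DiffOp D) (op_x k).
Proof. by move=> njk; rewrite /GRing.comm op_dx (negPf njk) mpolyC0 addr0. Qed.

Lemma op_theta_x_comm j k : j != k -> GRing.comm (op_theta j) (op_x k).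
Proof.
move=> njk; apply/commr_sym/commrM; first exact: op_x_comm.
exact/commr_sym/op_dx_comm.
Qed.

Lemma op_theta_comm j k : GRing.comm (op_theta j) (op_theta k).
Proof.
have [->//|njk] := eqVneq j k; apply: commrM; first exact: op_theta_x_comm.
apply/commr_sym/commrM; last exact: op_d_comm.
by apply: op_dx_comm; rewrite eq_sym.
Qed.

Lemma op_ell_comm j k : GRing.comm (op_ell j) (op_ell k).
Proof.
apply: ring_ell_comm.
- exact: op_theta_comm.
- exact: op_x_comm.
- exact: op_theta_x_comm.
- by move=> l; rewrite {1}/op_theta -mulrA op_dx eqxx.
- by move=> i y; apply: op_const_comm.
- by move=> i l y; apply: op_const_comm.
Qed.

Lemma op_basisS g k :
  op_basis (g + U_(k) *+ p)%MM = dmult D (op_basis g) (op_ell k).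
Proof.
rewrite [RHS](_ : _ = (op_basis g : DiffOp D) * op_ell k) // -mulrA.
rewrite -[op_ell k in RHS](prod_expr_eq op_ell) -prodrM_comm.
  rewrite /op_basis; congr (_ * _ : DiffOp D); apply: eq_bigr => i _.
    by rewrite modn_addU.
  by rewrite divn_addU // exprD.
by move=> i j _ _; apply/commrX/commr_sym/commrX/op_ell_comm.
Qed.

Lemma leading_theta k : leading 1 (op_theta k) (sym_theta x k).
Proof.
rewrite op_thetaE; apply: leading_refl; rewrite (leq_trans (mmeasureZ_le _ _ _)) //.
by rewrite msizeX mdeg1.
Qed.

Lemma leading_const_add (u : A) P (f : AX) : leading 1 P f -> leading 1 (P + u%:MP) f.
Proof.
move=> Pf; rewrite -[f]addr0; apply: leadingD => //; apply: leading_lower.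
by rewrite msizeC; case: eqP.
Qed.

Lemma leading_pow_prod (F : 'I_p -> DiffOp D) (f : AX) :
  (forall i, leading 1 (F i) f) -> leading p (\prod_(i < p) F i) (f ^+ p).
Proof.
move=> Ff; have := @leading_prod _ _ D _ (index_enum 'I_p) _ F (fun=> f) Ff.
by rewrite sum1_card prodr_const card_ord.
Qed.

(** The parameters have order 0 and disappear from each linear factor, so both products have p-th
    powers as leading parts. *)
Lemma leading_ell k : leading p (op_ell k) (sym_ell p x k).
Proof.
apply: leadingD.
  by apply: leading_pow_prod => i; apply/leading_const_add/leading_theta.
(* The factor x_k has order 0, whence the splitting of p as 0 + p. *)
apply: leadingN; rewrite -mul_mpolyC -[p in leading p]add0n.
apply: (@leading_dmult _ _ D 0 p); first by apply: leading_refl; rewrite msizeC; case: eqP.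
apply: leading_pow_prod => i; apply/leading_const_add.
by apply: leading_sum => j; apply: leading_theta.
Qed.

Lemma leading_basis g : leading (mdeg g) (op_basis g) (sym_basis p x g).
Proof.
have -> : mdeg g = (\sum_k 1 * (g k %% p) + \sum_k p * (g k %/ p))%N.
  rewrite mdegE -big_split /=; apply: eq_bigr => k _.
  by rewrite mul1n [(p * _)%N]mulnC addnC -divn_eq.
have -> : sym_basis p x g =
    (\prod_k sym_theta x k ^+ (g k %% p)) * \prod_k sym_ell p x k ^+ (g k %/ p).
  exact: big_split.
apply: (@leading_dmult _ _ D).
  by apply: leading_prod => k; apply/leading_exp/leading_theta.
by apply: leading_prod => k; apply/leading_exp/leading_ell.
Qed.

Definition op_comb c : AX := lincomb op_basis c.
Definition sym_comb c : AX := lincomb (sym_basis p x) c.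

Lemma op_combD c d : op_comb (c + d) = op_comb c + op_comb d.
Proof. exact: linearD. Qed.

Lemma op_combZ u c : op_comb (u *: c) = u *: op_comb c.
Proof. exact: linearZ. Qed.

Lemma op_comb_mul c k :
  dmult D (op_comb c) (op_ell k) = op_comb (c * 'X_[U_(k) *+ p]).
Proof.
elim/mpoly_addind: c => [|u g c IHc]; first by rewrite /op_comb mul0r !linear0 /dmult linear0.
rewrite mulrDl /op_comb !linearD dmultDl -/(op_comb _) IHc; congr (_ + _).
by rewrite -scalerAl -mpolyXD !linearZ /= dmultZl !lincombX op_basisS.
Qed.

Lemma sym_comb_size N c : (msize c <= N)%N -> (msize (sym_comb c) <= N)%N.
Proof.
move=> cN; rewrite (leq_trans (msize_sum _ _ _)) //; apply/bigmax_leqP_seq => g gc _.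
rewrite (leq_trans (mmeasureZ_le _ _ _)) // (leq_trans (sym_basis_size _ _ _)) //.
by rewrite (leq_trans (msize_mdeg_lt gc)).
Qed.

Lemma op_sym_comb_size N c : (msize c <= N.+1)%N -> (msize (op_comb c - sym_comb c) <= N)%N.
Proof.
move=> cN; rewrite /op_comb /sym_comb /lincomb -sumrB (leq_trans (msize_sum _ _ _)) //.
apply/bigmax_leqP_seq => g gc _; rewrite -scalerBr (leq_trans (mmeasureZ_le _ _ _)) //.
case/andP: (leading_basis g) => /leq_trans le_g _; apply: le_g.
by rewrite -ltnS (leq_trans (msize_mdeg_lt gc)).
Qed.

Lemma sym_comb_homog d c : c \is d.-homog -> sym_comb c \is d.-homog.
Proof.
move=> cd; rewrite /sym_comb /lincomb big_seq; apply: rpred_sum => g gc.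
by apply: dhomogZ; rewrite -(dhomog_mf cd gc); apply: sym_basis_homog.
Qed.

Variables (F : comNzRingType) (ev : {rmorphism A -> F}).
Hypothesis ev_x : forall k, ev (x k) = 0.

Lemma x_neq0 k : x k != 0.
Proof.
by apply: contraTneq isT => xk0; have /eqP := Dx k k; rewrite xk0 raddf0 eqxx eq_sym oner_eq0.
Qed.

Let det_neq0 N : \det (coeff_mx (sym_basis p x) N) != 0 :=
  det_sym_basis p N ev_x x_neq0.

Lemma sym_comb_inj c : sym_comb c = 0 -> c = 0.
Proof. exact: (lincomb_inj det_neq0). Qed.

(** Induction on the order of [P]: the v_g span a multiple of [P], and replacing them by the V_g
    leaves a remainder of lower order. The scalar [h] collects the determinants met on the way. *)
Lemma op_comb_span P : exists2 h, h != 0 & exists c, h *: P = op_comb c.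
Proof.
have [N] := ubnP (msize P); elim: N P => // N IHN P; rewrite ltnS => PN.
have [P0|P_neq0] := eqVneq P 0.
  by exists 1; [exact: oner_neq0 | exists 0; rewrite P0 scaler0 /op_comb linear0].
have [c cP cE] := lincomb_surj (@sym_basis_size _ _ p x) (leqnn (msize P)).
set h := \det _ in cE; have h0 : h != 0 by exact: det_neq0.
have szP : (msize P).-1.+1 = msize P by rewrite prednK // lt0n msize_poly_eq0.
have [|h' h'0 [c' c'E]] := IHN (h *: P - op_comb c).
  rewrite -cE -/(sym_comb c) -opprB msizeN -szP in PN *.
  by apply: leq_trans PN; rewrite ltnS; apply: op_sym_comb_size; rewrite szP.
exists (h' * h); first exact: mulf_neq0.
exists (c' + h' *: c); rewrite op_combD op_combZ -c'E.
by rewrite scalerBr scalerA subrK.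
Qed.

Definition op_ideal P := exists Q : 'I_m -> AX, P = \sum_k dmult D (Q k) (op_ell k).

(** After scaling, each left coefficient is a combination of the V_g, and right multiplication by
    l_k moves every index to one with k-th entry at least p. Scalars act on the left, so they pass
    through this multiplication. *)
Lemma op_ideal_comb P : op_ideal P ->
  exists2 h, h != 0 & exists2 c, reducible p c & h *: P = op_comb c.
Proof.
case=> Q ->; elim/big_ind: _ => [|P1 P2|k _].
- exists 1; first exact: oner_neq0.
  by exists 0; [exact: reducible0 | rewrite scaler0 /op_comb linear0].
- move=> [h1 h10 [c1 r1 E1]] [h2 h20 [c2 r2 E2]].
  exists (h1 * h2); first exact: mulf_neq0.
  exists (h2 *: c1 + h1 *: c2).
    by apply: reducibleD; apply: reducibleZ.
  rewrite op_combD !op_combZ -E1 -E2 scalerDr !scalerA.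
  by rewrite [h2 * h1]mulrC.
have [h h0 [c cE]] := op_comb_span (Q k).
exists h => //; exists (c * 'X_[U_(k) *+ p]); first exact: reducible_mulX.
by rewrite -dmultZl cE op_comb_mul.
Qed.

(** Each v_g is homogeneous of degree |g| and the v_g are independent, so the top component of the
    coefficient vector yields the symbol without cancellation. *)
Lemma op_ideal_top P : op_ideal P ->
  exists2 h, h != 0 & exists2 c, reducible p c & h *: top_part P = sym_comb c.
Proof.
case/op_ideal_comb=> h h0 [c rc hP]; exists h => //; rewrite -topZ // hP.
have [c0|c_neq0] := eqVneq c 0.
  exists 0; first exact: reducible0.
  by rewrite c0 /op_comb /sym_comb !linear0 /top_part raddf0.
have szc : (msize c).-1.+1 = msize c by rewrite prednK // lt0n msize_poly_eq0.
set d := (msize c).-1 in szc; have rd := reducible_pihomog (e := d) rc.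
have cd : (msize (c - pihomog mdeg d c) <= d)%N.
  by apply: msize_sub_pihomog; rewrite szc.
exists (pihomog mdeg d c) => //; apply: (@top_unique _ _ d).
- exact/sym_comb_homog/pihomogP.
- apply: contra_neq c_neq0 => /sym_comb_inj top0; apply/eqP.
  by move: cd; rewrite top0 subr0 -msize_poly_eq0 -szc ltnn.
(* The difference consists of the error between operators and symbols and of the lower components of
   [c]. *)
- have -> : op_comb c - sym_comb (pihomog mdeg d c)
      = (op_comb c - sym_comb c) + sym_comb (c - pihomog mdeg d c).
    by rewrite /sym_comb linearB addrA subrK.
  by apply: msizeD_leq; [apply: op_sym_comb_size; rewrite szc | apply: sym_comb_size].
Qed.

End Operators.

(** * The ideal of the s_k and its quotient over the fraction field *)

Section FractionSpan.
Variables (A : idomainType) (m p : nat) (x : 'I_m -> A).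
Variables (F : comNzRingType) (ev : {rmorphism A -> F}).
Hypothesis p_gt0 : (0 < p)%N.
Hypothesis ev_x : forall k, ev (x k) = 0.
Hypothesis x_neq0 : forall k, x k != 0.
Local Notation K := {fraction A}.
Local Notation KX := {mpoly K[m]}.
Local Notation to_frac := (@map_mpoly m A K (@FracField.tofrac A)).
Implicit Types (f : KX) (g : 'X_{1..m}) (k : 'I_m).

Definition frac_ell k : KX := to_frac (sym_ell p x k).
Definition frac_basis g : KX := to_frac (sym_basis p x g).
Definition frac_comb (c : KX) : KX := lincomb frac_basis c.
Definition red_span f := exists2 c, reducible p c & f = frac_comb c.

Lemma frac_det N : \det (coeff_mx frac_basis N) != 0.
Proof.
rewrite (coeff_mx_map (@FracField.tofrac A)) det_map_mx tofrac_eq0.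
exact: (det_sym_basis p N ev_x x_neq0).
Qed.

Lemma frac_basis_size g : (msize (frac_basis g) <= (mdeg g).+1)%N.
Proof.
apply: msize_leP => b; rewrite mcoeff_msupp mcoeff_map_mpoly tofrac_eq0 -mcoeff_msupp.
by move/msize_mdeg_lt/leq_trans; apply; apply: sym_basis_size.
Qed.

Lemma frac_comb_inj c : frac_comb c = 0 -> c = 0.
Proof. exact: (lincomb_inj frac_det). Qed.

Lemma frac_comb_surj f : exists c, frac_comb c = f.
Proof.
have [c _ cE] := lincomb_surj frac_basis_size (leqnn (msize f)).
exists ((\det (coeff_mx frac_basis (msize f)))^-1 *: c).
rewrite /frac_comb linearZ /= cE scalerA mulVf ?scale1r //; exact: frac_det.
Qed.

Lemma frac_combD c d : frac_comb (c + d) = frac_comb c + frac_comb d.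
Proof. exact: linearD. Qed.

Lemma frac_combZ u c : frac_comb (u *: c) = u *: frac_comb c.
Proof. exact: linearZ. Qed.

Lemma frac_basisS g k : frac_basis (g + U_(k) *+ p)%MM = frac_basis g * frac_ell k.
Proof. by rewrite /frac_basis sym_basisS // rmorphM. Qed.

Lemma frac_comb_mul c k :
  frac_comb c * frac_ell k = frac_comb (c * 'X_[U_(k) *+ p]).
Proof.
elim/mpoly_addind: c => [|u g c IHc]; first by rewrite /frac_comb mul0r !linear0 mul0r.
rewrite mulrDl !frac_combD mulrDl IHc; congr (_ + _).
by rewrite -scalerAl -mpolyXD !frac_combZ -scalerAl /frac_comb !lincombX frac_basisS.
Qed.

Lemma red_span0 : red_span 0.
Proof. by exists 0; [exact: reducible0 | rewrite /frac_comb linear0]. Qed.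

Lemma red_spanD f f' : red_span f -> red_span f' -> red_span (f + f').
Proof.
move=> [c rc ->] [d rd ->]; exists (c + d); first exact: reducibleD.
by rewrite frac_combD.
Qed.

Lemma red_span_ell f k : red_span (f * frac_ell k).
Proof.
have [c <-] := frac_comb_surj f; exists (c * 'X_[U_(k) *+ p]).
  exact: reducible_mulX.
exact: frac_comb_mul.
Qed.

(** An index with g_k >= p gives v_g = v_(g - p e_k) s_k. Conversely any multiplier of s_k expands
    in the v_g, whose indices are then shifted by p e_k. Hence [red_span] is the ideal generated by
    the s_k. *)
Lemma red_spanP f : red_span f <-> exists G : 'I_m -> KX, f = \sum_k G k * frac_ell k.
Proof.
split=> [[c rc ->]|[G ->]]; last first.
  elim/big_ind: _ => [||k _]; [exact: red_span0 | exact: red_spanD | exact: red_span_ell].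
rewrite /frac_comb /lincomb big_seq; elim/big_ind: _ => [|f1 f2 [G1 ->] [G2 ->]|g].
- by exists (fun=> 0); rewrite big1 // => k _; rewrite mul0r.
- exists (fun k => G1 k + G2 k); rewrite -big_split; apply: eq_bigr => k _.
  by rewrite mulrDl.
rewrite mcoeff_msupp => /rc [k gk].
exists (fun j => if j == k then c@_g *: frac_basis (g - U_(k) *+ p)%MM else 0).
rewrite (bigD1 k) //= eqxx big1 ?addr0 => [|j /negPf ->]; last by rewrite mul0r.
rewrite -scalerAl -frac_basisS submK //.
apply/mnm_lepP => j; rewrite mulmnE mnm1E.
by case: eqP => [<-|_]; rewrite ?mul1n ?mul0n.
Qed.

Lemma red_span_mul h f : red_span f -> red_span (h * f).
Proof.
move/red_spanP=> [G ->]; apply/red_spanP; exists (fun k => h * G k).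
by rewrite mulr_sumr; apply: eq_bigr => k _; rewrite mulrA.
Qed.

(** The scalar [h] left over from working without fractions becomes invertible here. *)
Lemma red_span_frac h (f : {mpoly A[m]}) c :
  h != 0 -> reducible p c -> h *: f = sym_comb p x c -> red_span (to_frac f).
Proof.
move=> h0 rc hf; exists ((FracField.tofrac h)^-1 *: to_frac c).
  apply: reducibleZ => g; rewrite mcoeff_map_mpoly tofrac_eq0; exact: rc.
rewrite frac_combZ /frac_comb lincomb_map; last by move=> u w /eqP; rewrite tofrac_eq => /eqP.
by rewrite -/(sym_comb p x c) -hf map_mpolyZ scalerA mulVf ?scale1r // tofrac_eq0.
Qed.

(** Finite functions encode the exponents in the box, which gives their number p^m at once. *)
Definition small_mnm (e : {ffun 'I_m -> 'I_p}) : 'X_{1..m} := [multinom (e k : nat) | k < m].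

Lemma small_mnm_inj : injective small_mnm.
Proof.
move=> e1 e2 /mnmP e12; apply/ffunP => k; apply: val_inj.
by have := e12 k; rewrite !mnmE.
Qed.

Lemma card_small : #|{ffun 'I_m -> 'I_p}| = (p ^ m)%N.
Proof. by rewrite card_ffun !card_ord. Qed.

Definition basis_mnm (i : 'I_(p ^ m)) : 'X_{1..m} :=
  small_mnm (enum_val (cast_ord (esym card_small) i)).

Lemma basis_mnm_inj : injective basis_mnm.
Proof. by move=> i j /small_mnm_inj/enum_val_inj/cast_ord_inj. Qed.

Lemma basis_mnm_small i k : (basis_mnm i k < p)%N.
Proof. by rewrite mnmE. Qed.

Lemma basis_mnm_onto g : (forall k, g k < p)%N -> exists i, basis_mnm i = g.
Proof.
move=> gp; pose e : {ffun 'I_m -> 'I_p} := [ffun k => Ordinal (gp k)].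
exists (cast_ord card_small (enum_rank e)).
by rewrite /basis_mnm cast_ordK enum_rankK; apply/mnmP => k; rewrite mnmE ffunE.
Qed.

Lemma small_comb_coeff (c : 'I_(p ^ m) -> K) i :
  (\sum_j c j *: 'X_[basis_mnm j] : KX)@_(basis_mnm i) = c i.
Proof.
rewrite raddf_sum (bigD1 i) //= big1 ?addr0 => [|j ji]; rewrite mcoeffZ mcoeffX.
  by rewrite eqxx mulr1.
by rewrite (inj_eq basis_mnm_inj) (negPf ji) mulr0.
Qed.

Lemma small_comb (c : 'I_(p ^ m) -> K) :
  \sum_i c i *: frac_basis (basis_mnm i) =
    frac_comb (\sum_i c i *: 'X_[basis_mnm i]).
Proof.
rewrite /frac_comb linear_sum; apply: eq_bigr => i _.
by rewrite linearZ /= lincombX.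
Qed.

(** Coordinates in the v_g are unique, and those of the given sum lie in the box while those of a
    member of [red_span] lie outside it. *)
Lemma quotient_free (c : 'I_(p ^ m) -> K) :
  red_span (\sum_i c i *: frac_basis (basis_mnm i)) -> forall i, c i = 0.
Proof.
rewrite small_comb => -[d rd cd] i.
have /frac_comb_inj/eqP : frac_comb (\sum_i c i *: 'X_[basis_mnm i] - d) = 0.
  by rewrite -scaleN1r frac_combD frac_combZ -cd scaleN1r subrr.
rewrite subr_eq0 => /eqP e; rewrite -[LHS](small_comb_coeff c i) e.
apply/eqP; apply/negPn/negP => /rd [k]; apply/negP.
by rewrite -ltnNge basis_mnm_small.
Qed.

(** Subtracting from [f] its coordinates in the box leaves a reducible coefficient vector. *)
Lemma quotient_span f : exists c : 'I_(p ^ m) -> K,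
  red_span (f - \sum_i c i *: frac_basis (basis_mnm i)).
Proof.
have [c <-] := frac_comb_surj f; exists (fun i => c@_(basis_mnm i)).
rewrite small_comb; set e := \sum_i _; exists (c - e); last first.
  by rewrite -(scaleN1r e) frac_combD frac_combZ scaleN1r.
move=> g; rewrite mcoeffB => cg; apply/existsP; apply: contraNT cg.
rewrite negb_exists => /forallP gp; have [k|i <-] := @basis_mnm_onto g.
  by rewrite ltnNge.
by rewrite (small_comb_coeff (fun i => c@_(basis_mnm i))) subrr.
Qed.

End FractionSpan.

(** * Specialization to the Weyl algebra *)

Section Weyl.
Variables (C : fieldType) (m p : nat).
Variables (a : 'I_p -> C) (b : 'I_p -> 'I_m -> C).
Local Notation Weyl := (Weyl C m).

Definition weyl_der : derivations {mpoly C[m]} m :=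
  Derivations (fun j => raddfB (mderiv j)) (@mderivM m C) (fun i j q => mderiv_comm j i q).

Lemma wmulE (P Q : Weyl) : wmul P Q = dmult weyl_der P Q.
Proof. by []. Qed.

Lemma psymbolE (P : Weyl) : psymbol P = top_part P.
Proof. by []. Qed.

Lemma ellE k : ell a b k = op_ell weyl_der (fun k => 'X_k)
   (fun i => (a i)%:MP) (fun i k => (b i k - 1)%:MP) k.
Proof. by []. Qed.

Lemma ideal_ellE (P : Weyl) : left_ideal_gen (ell a b) P ->
  op_ideal weyl_der (fun k => 'X_k) (fun i => (a i)%:MP) (fun i k => (b i k - 1)%:MP) P.
Proof. by case=> Q ->; exists Q; apply: eq_bigr => k _; rewrite wmulE ellE. Qed.

Lemma ell_in_ideal k : left_ideal_gen (ell a b) (ell a b k).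
Proof.
exists (fun j => (j == k)%:R); rewrite (bigD1 k) //= big1 => [|j /negPf jk].
  by rewrite eqxx addr0 wmulE dmult1l.
by rewrite jk wmulE /dmult linear0.
Qed.

Definition ev0 : {rmorphism {mpoly C[m]} -> C} := meval (fun=> 0).

Lemma ev0X k : ev0 'X_k = 0.
Proof. exact: mevalXU. Qed.

Lemma weyl_derX (j k : 'I_m) : weyl_der j 'X_k = (j == k)%:R.
Proof.
rewrite /= mderivX mnm1E eq_sym; case: eqP => [->|_]; last by rewrite scale0r.
rewrite scale1r -mpolyX0; congr mpolyX; apply/mnmP => i.
by rewrite mnmBE mnm0E subnn.
Qed.

Hypothesis p_gt0 : (0 < p)%N.

Lemma psymbol_ell k : psymbol (ell a b k) = sym_ell p (fun k => 'X_k) k.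
Proof.
rewrite psymbolE ellE.
have := leading_ell weyl_der (fun k => 'X_k) (fun i => (a i)%:MP) (fun i k => (b i k - 1)%:MP) k.
case/andP=> le_p _; apply: top_unique le_p; first exact: sym_ell_homog.
(* Non-vanishing of s_k: it equals v_(p e_k), a member of an independent family. *)
have := @sym_comb_inj _ m p weyl_der (fun k => 'X_k) weyl_derX _ ev0 ev0X 'X_[U_(k) *+ p].
rewrite /sym_comb lincombX -[(U_(k) *+ p)%MM]add0m sym_basisS //.
have -> : sym_basis p (fun k => 'X_k : {mpoly C[m]}) 0%MM = 1.
  by rewrite /sym_basis big1 // => j _; rewrite mnm0E mod0n div0n mulr1.
rewrite mul1r => inj; apply/eqP => /inj /eqP.
by rewrite -msize_poly_eq0 msizeX.
Qed.

(** The s_k are symbols of the generators l_k, which gives one inclusion. For the other,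
    [op_ideal_top] puts every symbol of the left ideal into [red_span], which absorbs
    multiplication. *)
Lemma ext_idealP (f : {mpoly {fraction {mpoly C[m]}}[m]}) :
  ext_ideal (left_ideal_gen (ell a b)) f <-> red_span p (fun k => 'X_k) f.
Proof.
have X0 k : 'X_k != 0 :> {mpoly C[m]} by rewrite -msize_poly_eq0 msizeX.
split=> [[n [g [s [s_in ->]]]]|/(red_spanP p_gt0 ev0X X0) [G ->]]; last first.
  exists m, G, (fun k => psymbol (ell a b k)); split=> [k|].
    by exists (ell a b k); first exact: ell_in_ideal.
  by apply: eq_bigr => k _; rewrite psymbol_ell.
elim/big_ind: _ => [||i _]; [exact: red_span0 | exact: red_spanD |].
apply: (red_span_mul p_gt0 ev0X X0); case: (s_in i) => P /ideal_ellE IP ->.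
have [||h h0 [c rc hP]] := op_ideal_top p_gt0 weyl_derX _ _ ev0X IP.
- by move=> i' j; apply: mderivC.
- by move=> i' k j; apply: mderivC.
by rewrite psymbolE; apply: red_span_frac h0 rc hP.
Qed.

Lemma has_rank_ell : has_rank (left_ideal_gen (ell a b)) (p ^ m).
Proof.
have X0 k : 'X_k != 0 :> {mpoly C[m]} by rewrite -msize_poly_eq0 msizeX.
exists (fun i => frac_basis p (fun k => 'X_k) (basis_mnm i)); split=> [c|f].
  by move/ext_idealP; exact: (@quotient_free _ _ _ _ _ ev0 ev0X X0).
have [c fc] := @quotient_span _ _ p _ _ ev0 ev0X X0 f.
by exists c; apply/ext_idealP.
Qed.

End Weyl.

Theorem mainTheorem5 (R : realType) (m p : nat)
    (a : 'I_p -> R[i]) (b : 'I_p -> 'I_m -> R[i]) :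
  (0 < p)%N ->
  (* b_{p,k} = 1 (the last index is p-1 since indices start at 0) *)
  (forall (j : 'I_p) (k : 'I_m), val j = p.-1 -> b j k = 1) ->
  (* b_{j,k} not in {0,-1,-2,...} for 1 <= j <= p-1 *)
  (forall (j : 'I_p) (k : 'I_m), (val j < p.-1)%N ->
      forall n : nat, b j k <> - n%:R) ->
  (* (C1) *)
  (forall (i : 'I_p) (J : 'I_m -> 'I_p),
      ~ is_int (a i - \sum_(k < m) b (J k) k)) ->
  (* (C2) *)
  (forall (j j' : 'I_p) (k : 'I_m), (val j < val j')%N ->
      ~ is_int (b j k - b j' k)) ->
  has_rank (left_ideal_gen (ell a b)) (p ^ m).
Proof. by move=> p_gt0 _ _ _ _; apply: has_rank_ell. Qed.
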